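(* Let $k$ be a kernel on $\mathbb{X}$, let $(\tilde P_1,\tilde P_2)$ be a pair of random probability measures on $\mathbb{X}$, and let $(X_{1,1},X_{2,1},X_{1,2},X_{2,2})$ be $\mathbb{X}$-valued random variables that, conditionally on $(\tilde P_1,\tilde P_2)$, are independent with $X_{i,j}\sim\tilde P_i$ for $i,j\in\{1,2\}$. Then $$\mathrm{Cov}_k(\tilde P_1,\tilde P_2)=\mathrm{Cov}_{\mathbb{H}_k}\big(k(X_{1,1},\cdot),k(X_{2,1},\cdot)\big),\qquad \mathrm{Var}_k(\tilde P_i)=\mathrm{Cov}_{\mathbb{H}_k}\big(k(X_{i,1},\cdot),k(X_{i,2},\cdot)\big)\quad(i=1,2).$$ In particular, if $\mathrm{Var}_k(\tilde P_i)>0$ for $i=1,2$, $$\mathrm{Corr}_k(\tilde P_1,\tilde P_2)=\frac{\mathrm{Cov}_{\mathbb{H}_k}(k(X_{1,1},\cdot),k(X_{2,1},\cdot))}{\sqrt{\mathrm{Cov}_{\mathbb{H}_k}(k(X_{1,1},\cdot),k(X_{1,2},\cdot))}\sqrt{\mathrm{Cov}_{\mathbb{H}_k}(k(X_{2,1},\cdot),k(X_{2,2},\cdot))}}.$$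
   Context: $\mathbb{X}$ is a locally compact Polish space with Borel $\sigma$-algebra $\mathcal{X}$. $\mathcal{M}_b(\mathbb{X})$ is the space of bounded (finite) signed measures on $\mathbb{X}$ and $\mathcal{P}(\mathbb{X})$ the subset of probability measures, both with the $\sigma$-algebra generated by the evaluation maps $\xi\mapsto\xi(A)$, $A\in\mathcal{X}$. A kernel on $\mathbb{X}$ is a measurable function $k:\mathbb{X}\times\mathbb{X}\to\mathbb{R}$ that is bounded, symmetric and positive-definite ($\sum_{i,j=1}^m a_ia_jk(x_i,x_j)\ge 0$ for all $m$, $x_i\in\mathbb{X}$, $a_i\in\mathbb{R}$). $\mathbb{H}_k$ is its reproducing kernel Hilbert space. The kernel mean embedding of $\xi\in\mathcal{M}_b(\mathbb{X})$ is $\mu_k(\xi)\in\mathbb{H}_k$, $\mu_k(\xi)(y)=\int k(x,y)\,d\xi(x)$; it satisfies $\langle\mu_k(\xi_1),\mu_k(\xi_2)\rangle_{\mathbb{H}_k}=\iint k\,d\xi_1\,d\xi_2$. For $\mathbb{H}_k$-valued random elements $U,V$ with square-integrable norm, $\mathrm{Cov}_{\mathbb{H}_k}(U,V)=\mathbb{E}[\langle U-\mathbb{E}[U],V-\mathbb{E}[V]\rangle_{\mathbb{H}_k}]$, where $\mathbb{E}[V]$ is characterised by $\langle h,\mathbb{E}[V]\rangle=\mathbb{E}\langle h,V\rangle$ for all $h\in\mathbb{H}_k$. A random probability is a random element of $\mathcal{P}(\mathbb{X})$. $\mathrm{Cov}_k(\tilde P_1,\tilde P_2)=\mathrm{Cov}_{\mathbb{H}_k}(\mu_k(\tilde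 P_1),\mu_k(\tilde P_2))$, $\mathrm{Var}_k(\tilde P)=\mathrm{Cov}_k(\tilde P,\tilde P)$, and when both kernel variances are positive, $\mathrm{Corr}_k(\tilde P_1,\tilde P_2)=\mathrm{Cov}_k(\tilde P_1,\tilde P_2)/\big(\sqrt{\mathrm{Var}_k(\tilde P_1)}\sqrt{\mathrm{Var}_k(\tilde P_2)}\big)$. *)

(* Defs.v *)
From HB Require Import structures.
From mathcomp Require Import all_boot all_order all_algebra.
From mathcomp Require Import all_classical all_reals all_analysis.

Set Implicit Arguments.
Unset Strict Implicit.
Unset Printing Implicit Defensive.

Import Order.TTheory GRing.Theory Num.Theory.
Import numFieldNormedType.Exports.

Local Open Scope classical_set_scope.
Local Open Scope ring_scope.

(* The first component is separability, the second complete metrizability;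
   nonnegativity of [dist] follows from the stated metric axioms. *)
Definition polish_space (R : realType) (T : topologicalType) : Prop :=
  (exists2 D : set T, countable D & dense D) /\
  (exists dist : T -> T -> R,
    [/\ forall x y, dist x y = 0 <-> x = y,
        forall x y, dist x y = dist y x,
        forall x y z, dist x z <= dist x y + dist y z,
        forall x (A : set T), nbhs x A <->
          exists2 e : R, 0 < e & [set y | dist x y < e] `<=` A &
        forall u : nat -> T,
          (forall e : R, 0 < e -> exists N, forall m n,
            (N <= m)%N -> (N <= n)%N -> dist (u m) (u n) < e) ->
          exists l : T, u @ \oo --> l]).

Notation borel T := (g_sigma_algebraType (@open T)).

(* Positive-definiteness is the weak inequality, [a] ranging over all real
   coefficient vectors and the points [x] not being assumed distinct. *)
Definition is_kernel (R : realType) (T : ptopologicalType)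
    (k : T -> T -> R) : Prop :=
  [/\ measurable_fun [set: borel T * borel T]
        (fun p : borel T * borel T => k p.1 p.2),
      exists M : R, forall x y, `|k x y| <= M,
      forall x y, k x y = k y x &
      forall (m : nat) (x : 'I_m -> T) (a : 'I_m -> R),
        0 <= \sum_(i < m) \sum_(j < m) a i * a j * k (x i) (x j)].

(* A real Hilbert space is a Banach space whose norm comes from an inner
   product; positive-definiteness of [hdot] is that of the norm. *)
HB.mixin Record CompleteNormedModule_isHilbert (R : realType) H
    & CompleteNormedModule R H := {
  hdot : H -> H -> R ;
  hdotC : forall u v, hdot u v = hdot v u ;
  hdotPl : forall (a : R) u v w, hdot (a *: u + v) w = a * hdot u w + hdot v w ;
  hdot_norm : forall u, hdot u u = `|u| ^+ 2
}.

#[short(type="hilbertType")]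
HB.structure Definition Hilbert (R : realType) :=
  {H of CompleteNormedModule R H & CompleteNormedModule_isHilbert R H}.

(* The reproducing kernel Hilbert space of k is a Hilbert space of functions
   T -> R: [rkhs_fun] is the linear embedding that presents its elements as
   functions, [ksec x] is the element k(x, .), and [reproducing] is the
   reproducing property. By the Moore-Aronszajn theorem such a space exists for
   every kernel and is unique up to an isometry compatible with [rkhs_fun]. *)
Record rkhs (R : realType) (T : Type) (k : T -> T -> R) := Rkhs {
  rkhs_space :> hilbertType R ;
  rkhs_fun : rkhs_space -> T -> R ;
  rkhs_funP : forall (a : R) u v y,
    rkhs_fun (a *: u + v) y = a * rkhs_fun u y + rkhs_fun v y ;
  rkhs_fun_inj : injective rkhs_fun ;
  ksec : T -> rkhs_space ;
  ksecE : forall x y, rkhs_fun (ksec x) y = k x y ;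
  reproducing : forall h x, hdot h (ksec x) = rkhs_fun h x
}.

Section hilbert_moments.
Context d (Omega : measurableType d) (R : realType) (P : probability Omega R).
Context (H : hilbertType R).

(* The weak (Pettis) expectation; it is unique when it exists, and 0 is the
   default value otherwise. *)
Definition hmean (V : Omega -> H) : H :=
  xget 0 [set m | forall h,
    ((hdot h m)%:E = 'E_P[(fun w => hdot h (V w))%R])%E].

Definition hcov (U V : Omega -> H) : R :=
  fine 'E_P[(fun w => hdot (U w - hmean U) (V w - hmean V))%R]%E.

End hilbert_moments.

Section kernel_embedding.
Context (R : realType) (T : ptopologicalType) (k : T -> T -> R) (H : rkhs k).

(* The element of H which, as a function, is y |-> \int k(x, y) dxi(x). *)
Definition kme (xi : {measure set (borel T) -> \bar R}) : H :=
  xget 0 [set h : H | forall y, rkhs_fun h y = \int[xi]_x k x y].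

Context d (Omega : measurableType d) (P : probability Omega R).
Implicit Types Q : Omega -> pprobability (borel T) R.

Definition kcov Q1 Q2 : R :=
  hcov P (fun w => kme (Q1 w)) (fun w => kme (Q2 w)).

Definition kvar Q : R := kcov Q Q.

Definition kcorr Q1 Q2 : R :=
  kcov Q1 Q2 / (Num.sqrt (kvar Q1) * Num.sqrt (kvar Q2)).

End kernel_embedding.

Section conditioning.
Context d (Omega : measurableType d) (R : realType) (P : probability Omega R).

(* Y is a version of the conditional probability P(E | G), for a
   sub-sigma-algebra G. *)
Definition cond_prob (G : set (set Omega)) (E : set Omega)
    (Y : Omega -> R) : Prop :=
  [/\ forall B : set R, measurable B -> G (Y @^-1` B),
      P.-integrable setT (EFin \o Y) &
      forall D, G D -> (\int[P]_(w in D) (Y w)%:E = P (E `&` D))%E].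

Context d' (S : measurableType d').

Definition cond_law (G : set (set Omega)) (X : Omega -> S)
    (Q : Omega -> pprobability S R) : Prop :=
  forall A, measurable A ->
    cond_prob G (X @^-1` A) (fun w => fine (Q w A)).

(* Mutual conditional independence given G. Subfamilies are covered by taking
   A i = setT, and any two versions of a conditional probability agree almost
   surely. *)
Definition cond_indep (G : set (set Omega)) (I : finType)
    (X : I -> Omega -> S) : Prop :=
  forall (A : I -> set S) (Y : I -> Omega -> R),
    (forall i, measurable (A i)) ->
    (forall i, cond_prob G (X i @^-1` A i) (Y i)) ->
    cond_prob G [set w | forall i, A i (X i w)] (fun w => \prod_i Y i w).

End conditioning.

(* Main.v *)
Require Import Defs.
From HB Require Import structures.
From mathcomp Require Import all_boot all_order all_algebra.
From mathcomp Require Import all_classical all_reals all_analysis.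
From mathcomp Require Import measurable_realfun giry ring lra.

Set Implicit Arguments.
Unset Strict Implicit.
Unset Printing Implicit Defensive.

Import Order.TTheory GRing.Theory Num.Theory.
Import numFieldNormedType.Exports.

Local Open Scope classical_set_scope.
Local Open Scope ring_scope.

(* For weakly measurable bounded U and V, the covariance is
   E<U, V> - <E U, E V>. Since <mu_k(xi), mu_k(eta)> is the integral of k
   against the product measure, and <ksec x, ksec y> = k x y, both covariances
   reduce to expectations of bounded measurable functions: h and k integrated
   against the random measures on one side, evaluated at the random points on
   the other. They agree because the law of (X, Y) is the mixture of the random
   product measures, which conditional independence gives on rectangles.
   The weak expectations exist by the Riesz representation theorem, which is
   also what makes every element of the RKHS a measurable function. *)

(** * Inner products, Cauchy-Schwarz and Riesz representation on a closed subspace *)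

Section hilbert.
Context (R : realType) (H : hilbertType R).
Implicit Types (u v w : H) (a : R).

Lemma hdotDl u v w : hdot (u + v) w = hdot u w + hdot v w.
Proof. by rewrite -[u in LHS]scale1r hdotPl mul1r. Qed.

Lemma hdot0l w : hdot 0 w = 0.
Proof. by apply: (@addrI _ (hdot 0 w)); rewrite -hdotDl !addr0. Qed.

Lemma hdotZl a u w : hdot (a *: u) w = a * hdot u w.
Proof. by rewrite -[a *: u]addr0 hdotPl hdot0l addr0. Qed.

Lemma hdotNl u w : hdot (- u) w = - hdot u w.
Proof. by rewrite -scaleN1r hdotZl mulN1r. Qed.

Lemma hdotBl u v w : hdot (u - v) w = hdot u w - hdot v w.
Proof. by rewrite hdotDl hdotNl. Qed.

Lemma hdotDr u v w : hdot w (u + v) = hdot w u + hdot w v.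
Proof. by rewrite hdotC hdotDl !(hdotC w). Qed.

Lemma hdotZr a u w : hdot w (a *: u) = a * hdot w u.
Proof. by rewrite hdotC hdotZl (hdotC w). Qed.

Lemma hdotBr u v w : hdot w (u - v) = hdot w u - hdot w v.
Proof. by rewrite hdotC hdotBl !(hdotC w). Qed.

Lemma hdot_inj u v : (forall w, hdot w u = hdot w v) -> u = v.
Proof.
move=> uv; apply/eqP; rewrite -subr_eq0 -normr_eq0 -sqrf_eq0 -hdot_norm.
by rewrite hdotBr uv subrr.
Qed.

Lemma normr_hdot_le u v : `|hdot u v| <= `|u| * `|v|.
Proof.
rewrite -ler_sqr ?nnegrE ?mulr_ge0// real_normK ?num_real// exprMn -!hdot_norm.
have [->|v0] := eqVneq v 0; first by rewrite hdotC !hdot0l mulr0 expr0n.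
have V0 : 0 < hdot v v by rewrite hdot_norm exprn_gt0 ?normr_gt0.
(* [w] is the component of [u] orthogonal to [v], scaled by [hdot v v] to avoid a division. *)
pose w := hdot v v *: u - hdot u v *: v.
have : 0 <= hdot w w by rewrite hdot_norm sqr_ge0.
rewrite /w !(hdotBl, hdotBr, hdotZl, hdotZr) (hdotC v u).
rewrite [leRHS](_ : _ = hdot v v * (hdot u u * hdot v v - hdot u v ^+ 2));
  last by ring.
by rewrite pmulr_rge0// subr_ge0.
Qed.

Lemma cvg_hdotl (u_ : nat -> H) u v : u_ @ \oo --> u ->
  hdot (u_ n) v @[n --> \oo] --> hdot u v.
Proof.
move=> /cvgrPdist_le u_u; apply/cvgrPdist_le => e e0.
have e'0 : 0 < e / (`|v| + 1) by rewrite divr_gt0// ltr_wpDl.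
near=> n; rewrite -hdotBl (le_trans (normr_hdot_le _ _))//.
have : `|u - u_ n| <= e / (`|v| + 1).
  by near: n; exact: u_u.
rewrite ler_pdivlMr ?ltr_wpDl// => h.
by rewrite (le_trans _ h)// ler_wpM2l// lerDl.
Unshelve. all: by end_near.
Qed.

(* The representer minimises [<u, u> - 2 L u] over [S]; the parallelogram law
   makes every minimising sequence Cauchy. *)
Lemma riesz_subspace (S : set H) (L : H -> R) (C : R) : S 0 ->
  (forall a u v, S u -> S v -> S (a *: u + v)) ->
  (forall (u_ : nat -> H) u, (forall n, S (u_ n)) -> u_ @ \oo --> u -> S u) ->
  (forall a u v, S u -> S v -> L (a *: u + v) = a * L u + L v) ->
  (forall u, S u -> `|L u| <= C * `|u|) ->
  exists2 m, S m & forall u, S u -> hdot u m = L u.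
Proof.
move=> S0 SP Scl LP LC.
pose J u := hdot u u - 2 * L u.
pose E := J @` S.
have hE : has_inf E.
  split; first by exists (J 0); exists 0.
  (* [J u] is at least [|u|^2 - 2 C |u| = (|u| - C)^2 - C^2]. *)
  exists (- C ^+ 2) => _ [u Su <-]; rewrite /J hdot_norm.
  have := LC u Su; rewrite ler_norml => /andP[_ h].
  have := sqr_ge0 (`|u| - C); nra.
have Jge u : S u -> inf E <= J u.
  by move=> Su; apply: ge_inf; [case: hE|exists u].
have /choice[u_ u_P] :
    forall n : nat, exists u, S u /\ J u < inf E + n.+1%:R^-1.
  move=> n; have n0 : 0 < n.+1%:R^-1 :> R by [].
  by have [_ [u Su <-] h] := inf_adherent n0 hE; exists u; split.
have Su n : S (u_ n) by have [] := u_P n.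
(* By the parallelogram law the left side is [2 J (u_ m) + 2 J (u_ n) - 4 J p] with [p] the
   midpoint, and [J p] is at least [inf E]. *)
have dist m n : `|u_ m - u_ n| ^+ 2 <= 2 * (m.+1%:R^-1 + n.+1%:R^-1).
  have SpD : S (2^-1 *: u_ m + 2^-1 *: u_ n).
    by apply: (SP) => //; rewrite -[2^-1 *: _]addr0; exact: SP.
  have := Jge _ SpD; have [_] := u_P m; have [_] := u_P n.
  have LE : L (2^-1 *: u_ m + 2^-1 *: u_ n) = 2^-1 * L (u_ m) + 2^-1 * L (u_ n).
    rewrite LP// -[2^-1 *: u_ n]addr0 ?LP//; last by exact: SP.
    suff -> : L 0 = 0 by rewrite addr0.
    by have := LP 1 0 0 S0 S0; rewrite scale1r addr0 mul1r; lra.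
  rewrite /J LE -hdot_norm.
  rewrite !(hdotBl, hdotDl, hdotBr, hdotDr, hdotNl, hdotZl, hdotZr).
  rewrite (hdotC (u_ n) (u_ m)).
  move: (n.+1%:R^-1 : R) (m.+1%:R^-1 : R) => e1 e2; lra.
have : cauchy (u_ @ \oo).
  apply/cauchyP => e e0.
  have e4 : 0 < e ^+ 2 / 4 by rewrite divr_gt0// exprn_gt0.
  have [N _ HN] := near_infty_natSinv_lt (PosNum e4).
  exists (u_ N), N => // n /= Nn; rewrite -ball_normE /=.
  rewrite -(@ltr_pXn2r _ 2) ?nnegrE ?(ltW e0)//.
  apply: (le_lt_trans (dist _ _)).
  have nN : n.+1%:R^-1 <= N.+1%:R^-1 :> R.
    by rewrite lef_pV2 ?posrE ?ltr0n// ler_nat.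
  have := HN N (leqnn N); rewrite /=.
  by move: (n.+1%:R^-1 : R) (N.+1%:R^-1 : R) nN => a b; lra.
move/cauchy_cvgP => cu; pose m := lim (u_ @ \oo).
have um : u_ @ \oo --> m by [].
exists m; first exact: Scl um.
move=> v Sv.
(* [2 c n] is the derivative of [J] at [u_ n] in direction [v]; near-minimality forces it to 0. *)
pose c n := hdot (u_ n) v - L v.
have cc : c n @[n --> \oo] --> hdot m v - L v.
  by apply: cvgB; [exact: cvg_hdotl|exact: cvg_cst].
pose V := hdot v v.
have V0 : 0 <= V by rewrite /V hdot_norm sqr_ge0.
have cle n : c n ^+ 2 <= n.+1%:R^-1 * (V + 1).
  (* Moving from [u_ n] to [u_ n + t v] changes [J] by [t^2 V + 2 t c n = - t^2 (V + 2)], a decrease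
     of at most [1/(n+1)]. Dividing by [V + 1] rather than [V] covers [v = 0]. *)
  pose t := - c n / (V + 1).
  have := Jge _ (SP t _ _ Sv (Su n)); have [_] := u_P n.
  rewrite /J LP// !(hdotDl, hdotDr, hdotZl, hdotZr) (hdotC v (u_ n)) -/V.
  have cE : c n = - t * (V + 1).
    by rewrite /t !mulNr opprK divfK// gt_eqF// ltr_wpDl.
  have -> : hdot (u_ n) v = c n + L v by rewrite /c subrK.
  move: cE; move: (c n) (t) (n.+1%:R^-1 : R) => x y e -> h1 h2.
  have : y ^+ 2 * (V + 1) <= e by nra.
  by move=> /(ler_wpM2r (addr_ge0 V0 ler01)); rewrite exprMn sqrrN expr2 -!mulrA.
apply/eqP; rewrite -subr_eq0 -sqrf_eq0 eq_le sqr_ge0 andbT.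
have c2 : c n ^+ 2 @[n --> \oo] --> (hdot m v - L v) ^+ 2 by exact: cvgM.
have b0 : n.+1%:R^-1 * (V + 1) @[n --> \oo] --> 0 * (V + 1).
  by apply: cvgM; [exact: cvg_harmonic|exact: cvg_cst].
rewrite mul0r in b0.
by rewrite hdotC; apply: (ler_cvg_to c2 b0); apply: nearW.
Qed.

End hilbert.

(** * Integrals of bounded functions against a probability *)

Section bounded_integrals.
Context d (S : measurableType d) (R : realType) (mu : probability S R).

Lemma integrable_le_cst (f : S -> R) (C : R) : measurable_fun setT f ->
  (forall x, `|f x| <= C) -> mu.-integrable setT (EFin \o f).
Proof.
move=> mf fC; apply: measurable_bounded_integrable => //.
  exact: le_lt_trans (probability_le1 mu measurableT) (ltry _).
exists C; split; first exact: num_real.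
by move=> x Cx y _ /=; rewrite (le_trans (fC _))// ltW.
Qed.

Lemma Rintegral_prob_cst (C : R) : \int[mu]_(x in setT) C = C.
Proof. by rewrite Rintegral_cst//= [mu _]probability_setT mulr1. Qed.

Lemma normr_Rintegral_le_cst (f : S -> R) (C : R) : measurable_fun setT f ->
  (forall x, `|f x| <= C) -> `|\int[mu]_x f x| <= C.
Proof.
move=> mf fC; have fi := integrable_le_cst mf fC.
rewrite (le_trans (le_normr_Rintegral _ _))//.
rewrite -[leRHS]Rintegral_prob_cst.
apply: le_Rintegral => //; last exact: finite_measure_integrable_cst.
by apply: integrable_norm fi.
Qed.

Lemma integrable_EFinB (f g : S -> R) : mu.-integrable setT (EFin \o f) ->
  mu.-integrable setT (EFin \o g) ->
  mu.-integrable setT (EFin \o (fun x => f x - g x)).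
Proof. by move=> fi gi; exact: (integrableB measurableT fi gi). Qed.

Lemma EFin_Rintegral (f : S -> R) : mu.-integrable setT (EFin \o f) ->
  (\int[mu]_x f x)%:E = (\int[mu]_x (f x)%:E)%E.
Proof. by move=> fi; rewrite fineK//; exact: integrable_fin_num. Qed.

End bounded_integrals.

(** * Weak expectation and covariance of bounded Hilbert-valued maps *)

Section weak_expectation.
Context d (S : measurableType d) (R : realType) (mu : probability S R).
Context (H : hilbertType R) (C : R).

(** Measurability is only asked after pairing with a fixed vector, since [H] is not assumed
    separable. Hence [hcovE] asks separately for measurability of the inner product of two such
    maps. *)
Definition weakly_bounded (V : S -> H) :=
  (forall h, measurable_fun setT (fun s => hdot h (V s))) /\
  (forall s, `|V s| <= C).

Lemma normr_hdot_weakly_bounded (V : S -> H) h s : weakly_bounded V ->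
  `|hdot h (V s)| <= `|h| * C.
Proof. by case=> _ VC; rewrite (le_trans (normr_hdot_le _ _))// ler_wpM2l. Qed.

Lemma integrable_hdot (V : S -> H) h : weakly_bounded V ->
  mu.-integrable setT (EFin \o (fun s => hdot h (V s))).
Proof.
move=> bV; apply: (@integrable_le_cst _ _ _ _ _ (`|h| * C)).
  by case: bV.
by move=> s; exact: normr_hdot_weakly_bounded.
Qed.

(** Riesz representation on the whole space, applied to the functional [h |-> \int <h, V>], which
    [C] bounds. *)
Lemma weak_integral_exists (V : S -> H) : weakly_bounded V ->
  exists2 m : H, `|m| <= C & forall h, hdot h m = \int[mu]_s hdot h (V s).
Proof.
move=> bV.
have Lle h : `|\int[mu]_s hdot h (V s)| <= C * `|h|.
  rewrite mulrC; apply: normr_Rintegral_le_cst; first by case: bV.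
  by move=> s; exact: normr_hdot_weakly_bounded.
have [||||//|m _ mE] :=
  @riesz_subspace _ H setT (fun h => \int[mu]_s hdot h (V s)) C => //.
  move=> a u v _ _; under eq_Rintegral do rewrite hdotDl.
  rewrite RintegralD//; try exact: integrable_hdot.
  under eq_Rintegral do rewrite hdotZl.
  by rewrite RintegralZl//; exact: integrable_hdot.
exists m; last by move=> h; exact: mE.
have := Lle m; rewrite -mE// hdot_norm ger0_norm// expr2.
(* Cancel [|m|] in [|m|^2 <= C |m|]. If [|m| = 0], the remaining claim [0 <= C] comes from the bound
   on [V] at [point]. *)
have [->|m0] := eqVneq (`|m|) 0; last by rewrite ler_pM2r// lt_neqAle eq_sym m0 /=.
by move=> _; case: bV => _ /(_ point); exact: le_trans.
Qed.

(** Existence guarantees that [xget] returns a genuine weak expectation and not its default 0. *)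
Lemma hdot_hmean (V : S -> H) h : weakly_bounded V ->
  hdot h (hmean mu V) = \int[mu]_s hdot h (V s).
Proof.
move=> bV; apply: EFin_inj; rewrite EFin_Rintegral; last exact: integrable_hdot.
have := @xgetPex _ 0 [set m : H | forall h,
  ((hdot h m)%:E = 'E_mu[(fun w => hdot h (V w))%R])%E].
rewrite -/(hmean mu V) unlock; apply.
have [m _ mE] := weak_integral_exists bV.
by exists m => g /=; rewrite mE EFin_Rintegral//; exact: integrable_hdot.
Qed.

(** After bilinear expansion each of the two cross terms integrates to the inner product of the
    means; the constant term cancels one of them. *)
Lemma hcovE (U V : S -> H) : weakly_bounded U -> weakly_bounded V ->
  measurable_fun setT (fun s => hdot (U s) (V s)) ->
  hcov mu U V = \int[mu]_s hdot (U s) (V s) - hdot (hmean mu U) (hmean mu V).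
Proof.
move=> bU bV mUV; rewrite /hcov unlock -/(Rintegral mu setT _).
have iUV : mu.-integrable setT (EFin \o (fun s => hdot (U s) (V s))).
  apply: (@integrable_le_cst _ _ _ _ _ (C * C)) => // s.
  rewrite (le_trans (normr_hdot_le _ _))// ler_pM//; [by case: bU|by case: bV].
under eq_Rintegral do rewrite !(hdotBl, hdotBr) (hdotC _ (hmean mu V)).
rewrite RintegralB//; last 2 first.
- by apply: integrable_EFinB => //; exact: integrable_hdot.
- apply: integrable_EFinB; first exact: integrable_hdot.
  exact: finite_measure_integrable_cst.
rewrite !RintegralB//; try exact: integrable_hdot; last first.
  exact: finite_measure_integrable_cst.
rewrite Rintegral_prob_cst -!hdot_hmean//.
by rewrite (hdotC (hmean mu V)); ring.
Qed.

End weak_expectation.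

(** * Measurability of RKHS functions and the kernel mean embedding *)

Section rkhs_kernel.
Context (R : realType) (T : ptopologicalType) (k : T -> T -> R).
Context (kP : is_kernel k) (H : rkhs k).

Lemma hdot_ksec x y : hdot (ksec H x) (ksec H y) = k x y.
Proof. by rewrite reproducing ksecE. Qed.

(* The measurable elements form a closed subspace containing every [ksec H x],
   so the orthogonal projection of [h] on it has the same values as [h]. *)
Lemma measurable_rkhs_fun (h : H) :
  measurable_fun [set: borel T] (rkhs_fun h : borel T -> R).
Proof.
pose S :=
  [set h : H | measurable_fun [set: borel T] (rkhs_fun h : borel T -> R)].
have Sksec x : S (ksec H x).
  have [mk _ _ _] := kP.
  rewrite /S /= (_ : rkhs_fun _ = fun y => k x y); last first.
    by apply/funext => y; exact: ksecE.
  exact: (measurable_fun_pair2 (x : borel T) mk).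
(* The projection [m] is the representer on [S] of the functional [u |-> hdot u h]. *)
have [|||||m Sm mE] := @riesz_subspace _ H S (fun u => hdot u h) `|h|.
- rewrite /S /= (_ : rkhs_fun _ = cst 0); first exact: measurable_cst.
  by apply/funext => y; rewrite -reproducing hdot0l.
- move=> a u v Su Sv.
  rewrite /S /= (_ : rkhs_fun _ = fun y => a * rkhs_fun u y + rkhs_fun v y).
    by apply: measurable_funD => //; exact: measurable_funM.
  by apply/funext => y; rewrite rkhs_funP.
(* By the reproducing property, norm convergence implies pointwise convergence, which preserves
   measurability. *)
- move=> u_ u Su u_u; apply: (measurable_fun_cvg Su) => y _.
  by rewrite -reproducing; under eq_cvg do rewrite -reproducing; exact: cvg_hdotl.
- by move=> a u v _ _; rewrite hdotPl.
- by move=> u _; rewrite mulrC normr_hdot_le.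
suff -> : h = m by [].
apply: rkhs_fun_inj; apply/funext => x.
by rewrite -!reproducing !(hdotC _ (ksec H x)) mE.
Qed.

(** The squared norm of [ksec H x] is [k x x <= M], and [M <= (M + 1)^2] spares a square root. *)
Lemma ksec_bounded : exists C, forall x, `|ksec H x| <= C.
Proof.
have [_ [M kM] _ _] := kP; exists (M + 1) => x.
have M0 : 0 <= M by apply: le_trans (kM x x).
have := kM x x; rewrite -hdot_ksec hdot_norm ger0_norm ?sqr_ge0// => h.
rewrite -(@ler_pXn2r _ 2) ?nnegrE ?addr_ge0// (le_trans h)//; nra.
Qed.

Context (C : R) (kC : forall x, `|ksec H x| <= C).

Lemma weakly_bounded_ksec d (S : measurableType d) (X : S -> borel T) :
  measurable_fun setT X -> weakly_bounded C (fun s => ksec H (X s)).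
Proof.
move=> mX; split=> [h|s]; last exact: kC.
under eq_fun do rewrite reproducing.
exact: measurableT_comp (measurable_rkhs_fun h) mX.
Qed.

(** Pairing the weak mean with [ksec H y] gives its value at [y], which is the integral defining
    [kme]; an element is determined by its values. *)
Lemma kmeE (xi : probability (borel T) R) :
  kme H xi = hmean xi (fun x : borel T => ksec H x).
Proof.
have bK := weakly_bounded_ksec (@measurable_id _ _ setT).
apply: xget_unique => [y|m mE].
  rewrite -reproducing hdotC (hdot_hmean _ _ bK).
  by apply: eq_Rintegral => x _; rewrite hdotC hdot_ksec.
apply: rkhs_fun_inj; apply/funext => y.
rewrite mE -reproducing hdotC (hdot_hmean _ _ bK).
by apply: eq_Rintegral => x _; rewrite hdotC hdot_ksec.
Qed.

Lemma hdot_kme (xi : probability (borel T) R) h :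
  hdot h (kme H xi) = \int[xi]_x rkhs_fun h x.
Proof.
have bK := weakly_bounded_ksec (@measurable_id _ _ setT).
rewrite kmeE (hdot_hmean _ _ bK).
by apply: eq_Rintegral => x _; rewrite reproducing.
Qed.

Lemma normr_kme_le (xi : probability (borel T) R) : `|kme H xi| <= C.
Proof.
have bK := weakly_bounded_ksec (@measurable_id _ _ setT).
have [m mC mE] := weak_integral_exists xi bK.
suff -> : kme H xi = m by [].
by apply: hdot_inj => h; rewrite kmeE (hdot_hmean _ _ bK) mE.
Qed.

(** Pairing with [kme H xi2] integrates the function [kme H xi1] against [xi2]; Fubini applies
    because [k] is bounded. *)
Lemma hdot_kme_kme (xi1 xi2 : probability (borel T) R) :
  hdot (kme H xi1) (kme H xi2) =
  \int[(xi1 \x xi2)%E]_p k p.1 p.2.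
Proof.
have [mk [M kM] _ _] := kP.
rewrite hdot_kme.
have kme1 y : rkhs_fun (kme H xi1) y = \int[xi1]_x k x y.
  rewrite -reproducing hdotC hdot_kme.
  by apply: eq_Rintegral => x _; rewrite ksecE; case: kP.
rewrite /Rintegral; congr fine.
have ki : (xi1 \x xi2)%E.-integrable setT
    (EFin \o (fun p : borel T * borel T => k p.1 p.2)).
  exact: (@integrable_le_cst _ _ _ _ _ M).
rewrite -(integral21_prod_meas1 ki); apply: eq_integral => y _.
rewrite kme1 EFin_Rintegral//.
apply: (@integrable_le_cst _ _ _ _ _ M) => //.
exact: (measurable_fun_pair1 (y : borel T) mk).
Qed.

End rkhs_kernel.

(** * Mixtures of a random probability *)

Section mixture.
Context d (Omega : measurableType d) d' (S : measurableType d') (R : realType).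
Context (P : probability Omega R) (K : Omega -> probability S R).
Hypothesis mK : forall A, measurable A -> measurable_fun setT (fun w => K w A).

Let mK_giry : measurable_fun setT (K : Omega -> giry S R).
Proof. exact: measurable_giry_codensity. Qed.

(** The law of a point drawn from [K w] after [w] is drawn from [P], obtained as the bind of the
    Giry monad. *)
Definition mixture : giry S R := giry_bind P mK_giry.

Lemma mixtureE A : measurable A -> mixture A = (\int[P]_w K w A)%E.
Proof.
move=> mA; rewrite /mixture /giry_bind /= giry_int_map//.
exact: measurable_giry_ev.
Qed.

Lemma ge0_integral_mixture (f : S -> \bar R) : measurable_fun setT f ->
  (forall x, 0 <= f x)%E ->
  (\int[mixture]_x f x = \int[P]_w \int[K w]_x f x)%E.
Proof. by move=> mf f0; exact: (giry_int_bind P mK_giry mf f0). Qed.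

(** Adding [C] makes [f] nonnegative, which reduces the claim to nonnegative integrands; subtracting
    [C] afterwards is harmless as each [K w] has mass 1. *)
Lemma measurable_Rintegral_kernel (f : S -> R) (C : R) :
  measurable_fun setT f -> (forall x, `|f x| <= C) ->
  measurable_fun setT (fun w => \int[K w]_x f x).
Proof.
move=> mf fC.
have fi w : (K w).-integrable setT (EFin \o f) by exact: integrable_le_cst fC.
have g0 x : 0 <= f x + C by have := fC x; rewrite ler_norml; lra.
have mg : measurable_fun setT (fun x => (f x + C)%:E).
  by apply/measurable_EFinP; apply: measurable_funD.
have -> : (fun w => \int[K w]_x f x) =
    (fun w => fine (\int[K w]_x (f x + C)%:E)%E - C).
  apply/funext => w; rewrite -/(Rintegral (K w) setT (fun x => f x + C)).
  rewrite RintegralD//; [|exact: fi|exact: finite_measure_integrable_cst].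
  by rewrite Rintegral_prob_cst addrK.
apply: measurable_funD => //; apply: measurableT_comp => //.
by apply: measurable_fun_integral_kernel => // x; rewrite lee_fin.
Qed.

(** The same shift by [C] brings in the formula for nonnegative functions. Taking any [nu] that
    agrees with the mixture on sets lets the lemma apply to laws of random variables. *)
Lemma Rintegral_mixture (nu : probability S R) (f : S -> R) (C : R) :
  (forall A, measurable A -> nu A = (\int[P]_w K w A)%E) ->
  measurable_fun setT f -> (forall x, `|f x| <= C) ->
  \int[nu]_x f x = \int[P]_w \int[K w]_x f x.
Proof.
move=> nuE mf fC.
have fi (mu : probability S R) : mu.-integrable setT (EFin \o f).
  exact: integrable_le_cst fC.
have g0 x : 0 <= f x + C by have := fC x; rewrite ler_norml; lra.
have mg : measurable_fun setT (fun x => (f x + C)%:E).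
  by apply/measurable_EFinP; apply: measurable_funD.
have gE (mu : probability S R) :
    (\int[mu]_x (f x + C)%:E)%E = (\int[mu]_x f x + C)%:E.
  rewrite -EFin_Rintegral.
    rewrite RintegralD//; [|exact: fi|exact: finite_measure_integrable_cst].
    by rewrite Rintegral_prob_cst.
  apply: (@integrable_le_cst _ _ _ _ _ (C + C)) => [|x].
    by apply: measurable_funD.
  by have := fC x; rewrite !ler_norml; lra.
have : (\int[nu]_x (f x + C)%:E = \int[P]_w \int[K w]_x (f x + C)%:E)%E.
  rewrite -ge0_integral_mixture//.
  apply: eq_measure_integral => A mA _.
  exact: etrans (nuE A mA) (esym (mixtureE mA)).
rewrite gE; under eq_integral do rewrite gE.
have mf' := measurable_Rintegral_kernel mf fC.
have f'C w : `|\int[K w]_x f x| <= C by exact: normr_Rintegral_le_cst.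
rewrite -EFin_Rintegral; last first.
  apply: (@integrable_le_cst _ _ _ _ _ (C + C)) => [|w].
    by apply: measurable_funD.
  by have := f'C w; rewrite !ler_norml; lra.
rewrite RintegralD//; last 2 first.
- exact: integrable_le_cst f'C.
- exact: finite_measure_integrable_cst.
rewrite Rintegral_prob_cst.
by move=> [] /addIr.
Qed.

End mixture.

(** * Mixtures of random product measures *)

Section product_mixture.
Context d (Omega : measurableType d) (R : realType) (P : probability Omega R).
Context d1 d2 (S1 : measurableType d1) (S2 : measurableType d2).
Context (K1 : Omega -> probability S1 R) (K2 : Omega -> probability S2 R).
Hypothesis mK1 : forall A,
  measurable A -> measurable_fun setT (fun w => K1 w A).
Hypothesis mK2 : forall A,
  measurable A -> measurable_fun setT (fun w => K2 w A).

Definition kernel_prod (w : Omega) : probability (S1 * S2)%type R :=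
  (K1 w \x K2 w)%E.

Lemma measurable_kernel_prod A : measurable A ->
  measurable_fun setT (fun w => kernel_prod w A).
Proof.
move=> mA.
have m1 : measurable_fun setT (K1 : Omega -> giry S1 R).
  exact: measurable_giry_codensity.
have m2 : measurable_fun setT (K2 : Omega -> giry S2 R).
  exact: measurable_giry_codensity.
apply: (measurableT_comp (measurable_giry_ev mA)
  (measurableT_comp measurable_giry_prod (measurable_fun_pair m1 m2))).
Qed.

Lemma product_mixture_unique (nu : probability (S1 * S2)%type R) :
  (forall A B, measurable A -> measurable B ->
    nu (A `*` B) = (\int[P]_w (K1 w A * K2 w B))%E) ->
  forall E, measurable E -> nu E = (\int[P]_w kernel_prod w E)%E.
Proof.
move=> nuE E mE; rewrite -(mixtureE P measurable_kernel_prod mE).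
(* Rectangles are stable under intersection and generate the product sigma-algebra, so they
   determine a finite measure. *)
pose G : set (set (S1 * S2)) :=
  [set A `*` B | A in measurable & B in measurable].
apply: (measure_unique G (fun=> setT)) => //.
- exact: measurable_prod_measurableType.
- move=> _ _ [A1 mA1 [B1 mB1 <-]] [A2 mA2 [B2 mB2 <-]].
  exists (A1 `&` A2); first exact: measurableI.
  by exists (B1 `&` B2); [exact: measurableI|rewrite setXI].
- by move=> _; exists setT => //; exists setT => //; rewrite setXTT.
- by rewrite bigcup_const.
- move=> _ [A mA [B mB <-]].
  apply: etrans (nuE A B mA mB)
    (esym (etrans (mixtureE _ _ (measurableX mA mB)) _)).
  by apply: eq_integral => w _; rewrite /kernel_prod /= product_measure1E.
- by move=> _; exact: le_lt_trans (probability_le1 nu measurableT) (ltry _).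
Qed.

End product_mixture.

(** * Random probabilities and joint laws under conditional independence *)

Lemma measurable_pprobability_ev d (Omega : measurableType d) d'
    (S : measurableType d') (R : realType)
    (Q : {mfun Omega >-> pprobability S R}) A :
  measurable A -> measurable_fun setT (fun w => Q w A).
Proof.
exact: (@measurable_kernel _ _ _ _ _
  (kprobability (@measurable_funPT _ _ _ _ Q))).
Qed.

Lemma cond_indep_pair d (Omega : measurableType d) d' (S : measurableType d')
    (R : realType) (P : probability Omega R) (G : set (set Omega)) (I : finType)
    (X : I -> Omega -> S) (Q : I -> Omega -> pprobability S R) :
  G setT -> (forall i, cond_law P G (X i) (Q i)) -> cond_indep P G X ->
  forall a b A B, a != b -> measurable A -> measurable B ->
  P (X a @^-1` A `&` X b @^-1` B) = (\int[P]_w (Q a w A * Q b w B))%E.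
Proof.
move=> GT lawX indX a b A B ab mA mB.
(* With [setT] at the other indices the product of conditional probabilities has only two nontrivial
   factors; integrating it over the whole space gives the joint law. *)
pose D i := if i == a then A else if i == b then B else setT.
have mD i : measurable (D i) by rewrite /D; case: ifP => // _; case: ifP.
have Da : D a = A by rewrite /D eqxx.
have Db : D b = B by rewrite /D eq_sym (negbTE ab) eqxx.
have [_ _ /(_ setT GT)] := indX D _ mD (fun i => lawX i _ (mD i)).
rewrite setIT (_ : [set w | _] = X a @^-1` A `&` X b @^-1` B); last first.
  apply/seteqP; split=> [w Dw|w [Aw Bw] i].
    by split; [have := Dw a; rewrite Da|have := Dw b; rewrite Db].
  by rewrite /D; case: eqVneq => [->//|_]; case: eqVneq => [->|].
move=> <-; apply: eq_integral => w _.
rewrite (bigD1 a)//= (bigD1 b) 1?eq_sym//= big1 ?mulr1; last first.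
  move=> i /andP[ia ib]; rewrite /D (negbTE ia) (negbTE ib).
  by rewrite probability_setT.
by rewrite Da Db EFinM !fineK//; exact: fin_num_measure.
Qed.

(** * Kernel covariance as covariance of kernel sections at sampled points *)

Section kernel_covariance.
Context (R : realType) (T : ptopologicalType) (k : T -> T -> R).
Context (kP : is_kernel k) (H : rkhs k).
Context d (Omega : measurableType d) (P : probability Omega R).
Context (C : R) (kC : forall x, `|ksec H x| <= C).

Let normr_rkhs_fun_le (h : H) x : `|rkhs_fun h x| <= `|h| * C.
Proof. by rewrite -reproducing (le_trans (normr_hdot_le _ _))// ler_wpM2l. Qed.

Lemma weakly_bounded_kme (Q : {mfun Omega >-> pprobability (borel T) R}) :
  weakly_bounded C (fun w => kme H (Q w)).
Proof.
split=> [h|w]; last exact: normr_kme_le.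
rewrite (_ : (fun w => _) = fun w => \int[Q w]_x rkhs_fun h x); last first.
  by apply/funext => w; exact: hdot_kme.
apply: measurable_Rintegral_kernel (measurable_rkhs_fun kP h) _.
- exact: measurable_pprobability_ev.
- exact: normr_rkhs_fun_le.
Qed.

(** Tested against [h], both sides are the integral of the bounded function [rkhs_fun h] against the
    law of [X]. *)
Lemma hmean_kme (Q : {mfun Omega >-> pprobability (borel T) R})
    (X : {mfun Omega >-> borel T}) :
  (forall A, measurable A -> P (X @^-1` A) = (\int[P]_w Q w A)%E) ->
  hmean P (fun w => kme H (Q w)) = hmean P (fun w => ksec H (X w)).
Proof.
move=> XQ; apply: hdot_inj => h.
have mX : measurable_fun setT X by exact: measurable_funPT.
rewrite (hdot_hmean _ _ (weakly_bounded_kme Q)).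
rewrite (hdot_hmean _ _ (weakly_bounded_ksec kP kC mX)).
under eq_Rintegral do rewrite (hdot_kme kP kC).
under [RHS]eq_Rintegral do rewrite reproducing.
rewrite -(@Rintegral_mixture _ _ _ _ _ _ (fun w => Q w)
  (@measurable_pprobability_ev _ _ _ _ _ Q) (distribution P X) _ _ _
  (measurable_rkhs_fun kP h) (normr_rkhs_fun_le h)) //.
rewrite /Rintegral integral_distribution//.
  by apply/measurable_EFinP; apply: (measurable_rkhs_fun kP h).
apply: (@integrable_le_cst _ _ _ _ _ (`|h| * C)) => //.
exact: measurableT_comp (measurable_rkhs_fun kP h) mX.
Qed.

(** Covers covariance and variance at once: for the latter [Q1 = Q2], with [X] and [Y] two separate
    draws. *)
Lemma kcov_hcov_ksec (Q1 Q2 : {mfun Omega >-> pprobability (borel T) R})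
    (X Y : {mfun Omega >-> borel T}) :
  (forall A B, measurable A -> measurable B ->
    P (X @^-1` A `&` Y @^-1` B) = (\int[P]_w (Q1 w A * Q2 w B))%E) ->
  kcov H P Q1 Q2 = hcov P (fun w => ksec H (X w)) (fun w => ksec H (Y w)).
Proof.
move=> XYQ.
have XQ A : measurable A -> P (X @^-1` A) = (\int[P]_w Q1 w A)%E.
  move=> mA; have := XYQ A setT mA measurableT; rewrite preimage_setT setIT => ->.
  by apply: eq_integral => w _; rewrite probability_setT mule1.
have YQ B : measurable B -> P (Y @^-1` B) = (\int[P]_w Q2 w B)%E.
  move=> mB; have := XYQ setT B measurableT mB; rewrite preimage_setT setTI => ->.
  by apply: eq_integral => w _; rewrite probability_setT mul1e.
have [mk [M kM] _ _] := kP.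
have mX : measurable_fun setT X by exact: measurable_funPT.
have mY : measurable_fun setT Y by exact: measurable_funPT.
have mXY : measurable_fun setT (fun w => (X w, Y w)) by exact: measurable_fun_pair.
(* The law of the pair is the mixture of the products of [Q1 w] and [Q2 w], by uniqueness from
   rectangles. *)
pose Z : {mfun Omega >-> (borel T * borel T)%type} :=
  HB.pack (fun w => (X w, Y w)) (isMeasurableFun.Build _ _ _ _ _ mXY).
have mQ1 := @measurable_pprobability_ev _ _ _ _ _ Q1.
have mQ2 := @measurable_pprobability_ev _ _ _ _ _ Q2.
have ZQ := @product_mixture_unique _ _ _ P _ _ _ _ _ _ mQ1 mQ2
  (distribution P Z) XYQ.
have mQ := measurable_kernel_prod mQ1 mQ2.
have kM' (p : borel T * borel T) : `|k p.1 p.2| <= M by [].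
rewrite /kcov (hcovE P (weakly_bounded_kme Q1) (weakly_bounded_kme Q2)); last first.
  rewrite (_ : (fun w => _) = fun w =>
      \int[kernel_prod (fun w => Q1 w) (fun w => Q2 w) w]_p k p.1 p.2); last first.
    by apply/funext => w; exact: (hdot_kme_kme kP kC).
  refine (measurable_Rintegral_kernel mQ mk kM').
rewrite (hcovE P (weakly_bounded_ksec kP kC mX) (weakly_bounded_ksec kP kC mY)).
  (* The means agree by the marginal laws, leaving the expectations of the inner products to
     compare. *)
  rewrite (hmean_kme XQ) (hmean_kme YQ); congr (_ - _).
  under eq_Rintegral do rewrite (hdot_kme_kme kP kC).
  under [RHS]eq_Rintegral do rewrite hdot_ksec.
  rewrite -(Rintegral_mixture mQ ZQ mk kM').
  rewrite /Rintegral integral_distribution//.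
    exact/measurable_EFinP.
  apply: (@integrable_le_cst _ _ _ _ _ M) => //.
  exact: measurableT_comp mk mXY.
under eq_fun do rewrite hdot_ksec.
exact: measurableT_comp mk mXY.
Qed.

End kernel_covariance.

(* The indices 1, 2 of the text are 0, 1 : 'I_2. *)
Theorem theorem7 (R : realType) (T : ptopologicalType)
  (T_polish : polish_space R T) (T_lcompact : locally_compact [set: T])
  (k : T -> T -> R) (k_kernel : is_kernel k) (H : rkhs k)
  (d : measure_display) (Omega : measurableType d) (P : probability Omega R)
  (Pt : 'I_2 -> {mfun Omega >-> pprobability (borel T) R})
  (X : 'I_2 -> 'I_2 -> {mfun Omega >-> borel T})
  (X_law : forall i j : 'I_2,
    cond_law P (g_sigma_algebra_preimage (fun w => (Pt 0 w, Pt 1 w)))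
      (X i j) (Pt i))
  (X_indep :
    cond_indep P (g_sigma_algebra_preimage (fun w => (Pt 0 w, Pt 1 w)))
      (fun ij : 'I_2 * 'I_2 => X ij.1 ij.2 : Omega -> borel T)) :
  [/\ kcov H P (Pt 0) (Pt 1) =
        hcov P (fun w => ksec H (X 0 0 w)) (fun w => ksec H (X 1 0 w)),
      forall i : 'I_2, kvar H P (Pt i) =
        hcov P (fun w => ksec H (X i 0 w)) (fun w => ksec H (X i 1 w)) &
      (forall i : 'I_2, 0 < kvar H P (Pt i)) ->
      kcorr H P (Pt 0) (Pt 1) =
        hcov P (fun w => ksec H (X 0 0 w)) (fun w => ksec H (X 1 0 w)) /
        (Num.sqrt (hcov P (fun w => ksec H (X 0 0 w))
                          (fun w => ksec H (X 0 1 w))) *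
         Num.sqrt (hcov P (fun w => ksec H (X 1 0 w))
                          (fun w => ksec H (X 1 1 w))))].
Proof.
have [C kC] := ksec_bounded k_kernel H.
have GT : g_sigma_algebra_preimage (fun w => (Pt 0 w, Pt 1 w)) setT.
  by exists setT => //; rewrite preimage_setT setIT.
have joint a b A B : a != b -> measurable A -> measurable B ->
    P (X a.1 a.2 @^-1` A `&` X b.1 b.2 @^-1` B) =
    (\int[P]_w (Pt a.1 w A * Pt b.1 w B))%E.
  apply: (@cond_indep_pair _ _ _ _ _ P _ _
    (fun ij : 'I_2 * 'I_2 => X ij.1 ij.2 : Omega -> borel T)
    (fun ij : 'I_2 * 'I_2 => Pt ij.1 : Omega -> pprobability (borel T) R) GT) => //.
have covE : kcov H P (Pt 0) (Pt 1) =
    hcov P (fun w => ksec H (X 0 0 w)) (fun w => ksec H (X 1 0 w)).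
  apply: (kcov_hcov_ksec k_kernel kC) => A B mA mB.
  exact: (joint (0, 0) (1, 0)).
have varE i : kvar H P (Pt i) =
    hcov P (fun w => ksec H (X i 0 w)) (fun w => ksec H (X i 1 w)).
  apply: (kcov_hcov_ksec k_kernel kC) => A B mA mB.
  (* The two draws share [Pt i] but have distinct second indices, so conditional independence
     applies. *)
  by apply: (joint (i, 0) (i, 1)) => //; rewrite xpair_eqE andbF.
split; [exact: covE|exact: varE|move=> _].
by rewrite /kcorr covE !varE.
Qed.
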